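(* Let $m,n,k$ be integers with $m,n\ge k\ge 3$. (i) The maximum number of $1$'s in an $m\times n$ $(0,1)$-matrix which is $12\cdots k$-avoiding is $(k-1)(m+n-(k-1))$. (ii) The set of $1$'s of every $12\cdots k$-avoiding $m\times n$ $(0,1)$-matrix with exactly $(k-1)(m+n-(k-1))$ $1$'s can be partitioned into $k-1$ R-L zigzag paths of lengths $m+n-1, m+n-3, m+n-5,\dots, m+n-(2k-3)$, respectively. (iii) If $A$ is a $12\cdots k$-avoiding $m\times n$ $(0,1)$-matrix containing fewer than $(k-1)(m+n-(k-1))$ $1$'s, then there is a $0$ in $A$ that can be replaced with a $1$ so that the resulting matrix is still $12\cdots k$-avoiding.
   Context: An $m\times n$ $(0,1)$-matrix $A=[a_{ij}]$ is $12\cdots k$-avoiding if there do not exist rows $i_1<\cdots<i_k$ and columns $j_1<\cdots<j_k$ with $a_{i_1j_1}=\cdots=a_{i_kj_k}=1$. An R-L zigzag path is a sequence of positions $(p,q)=(r_1,c_1),(r_2,c_2),\dots,(r_\ell,c_\ell)=(u,v)$ with $u\ge p$, $v\le q$, in which each step goes from a position to the position immediately to its left or immediately below it (so it is a complete R-L zigzag path of the contiguous submatrix with rows $p,\dots,u$ and columns $v,\dots,q$, running from its upper right corner to its lower left corner); its length is its number of positions $\ell=(u-p)+(q-v)+1$. In (ii) every position of each path holds a $1$ of $A$ and each $1$ of $A$ lies on exactly one of the paths. *)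

(* Defs.v *)
From mathcomp Require Import all_boot all_order all_algebra.

Set Implicit Arguments.
Unset Strict Implicit.
Unset Printing Implicit Defensive.

(* A (0,1)-matrix is a boolean matrix; rows and columns are indexed from 0,
   rows from top to bottom and columns from left to right. *)

Definition ones (m n : nat) (A : 'M[bool]_(m, n)) : {set 'I_m * 'I_n} :=
  [set x | A x.1 x.2].

Definition contains_incr (k m n : nat) (A : 'M[bool]_(m, n)) : Prop :=
  exists (r : 'I_k -> 'I_m) (c : 'I_k -> 'I_n),
    [/\ (forall s t : 'I_k, s < t -> r s < r t),
        (forall s t : 'I_k, s < t -> c s < c t) &
        forall t : 'I_k, A (r t) (c t)].

Definition avoids_incr (k m n : nat) (A : 'M[bool]_(m, n)) : Prop :=
  ~ contains_incr k A.

Definition rl_step (m n : nat) : rel ('I_m * 'I_n) := fun x y =>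
  ((y.1 == x.1) && (y.2.+1 == x.2 :> nat))
  || ((y.1 == x.1.+1 :> nat) && (y.2 == x.2)).

(* The corners of the submatrix traversed are the endpoints of the path, and
   the formula for the length follows from the steps. *)
Definition rl_zigzag (m n : nat) (s : seq ('I_m * 'I_n)) : bool :=
  (s != [::]) && sorted (@rl_step m n) s.

Definition set_one (m n : nat) (A : 'M[bool]_(m, n)) (i : 'I_m) (j : 'I_n) :
    'M[bool]_(m, n) :=
  \matrix_(a < m, b < n) (((a == i) && (b == j)) || A a b).

(* Main.v *)
Require Import Defs.
From mathcomp Require Import all_boot all_order all_algebra.
From mathcomp Require Import zify.

(** Let the level of a position be the length of a longest increasing chain of
    1's strictly above and to the left of it. The 1's of level [t] are pairwise
    incomparable and lie in rows and columns of index at least [t], so each of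
    the [m + n - (2 * t + 1)] diagonals of that submatrix contains at most one
    of them; summing over the [k - 1] possible levels gives the bound. In case
    of equality each of these diagonals contains exactly one, and 1's of the
    same level on consecutive diagonals are adjacent, which gives the paths.
    For (iii), first turn into 1's the positions of the two corners
    whose diagonals are too short for an increasing chain of length [k]. The
    positions [(i, j)] such that the longest chain in [0..i] x [0..j] is longer
    than the one in [0..i-1] x [0..j-1] still avoid chains of length [k], include
    all the 1's, and meet every diagonal at every level it can carry. *)

Set Implicit Arguments.
Unset Strict Implicit.
Unset Printing Implicit Defensive.

(** * Longest increasing chains of a relation on the natural numbers *)

Section Level.

Variable a : rel nat.

(* The maximum length of an increasing chain of [a] in rows [< i] and columns
   [< j], by the recursion of the longest common subsequence problem. *)
Fixpoint lvl (i : nat) : nat -> nat :=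
  if i is i'.+1 then
    fix row (j : nat) : nat :=
      if j is j'.+1 then
        maxn (maxn (lvl i' j'.+1) (row j')) (lvl i' j' + a i' j')
      else 0
  else fun=> 0.

(** These are the positions where 1's can be put, even all at once, without changing [lvl]. *)
Definition jump (i j : nat) : bool := lvl i j < lvl i.+1 j.+1.

Lemma lvln0 i : lvl i 0 = 0. Proof. by case: i. Qed.

Lemma lvlSS i j : lvl i.+1 j.+1 =
  maxn (maxn (lvl i j.+1) (lvl i.+1 j)) (lvl i j + a i j).
Proof. by []. Qed.

Lemma lvl_mono i j i' j' : i <= i' -> j <= j' -> lvl i j <= lvl i' j'.
Proof.
move=> le_i le_j; apply: (@leq_trans (lvl i' j)).
  rewrite -(subnKC le_i); elim: (i' - i) => [|d IHd]; first by rewrite addn0.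
  rewrite (leq_trans IHd) // addnS; case: {IHd le_j} j => [|j].
    by rewrite !lvln0.
  by rewrite lvlSS; lia.
rewrite -(subnKC le_j); elim: (j' - j) => [|d IHd]; first by rewrite addn0.
rewrite (leq_trans IHd) // addnS; case: {IHd le_i} i' => [|i'] //.
by rewrite lvlSS; lia.
Qed.

Lemma lvl_le_row i j : lvl i j <= i.
Proof.
elim: i j => [|i IHi] //; elim=> [|j IHj]; first by rewrite lvln0.
by rewrite lvlSS; have := IHi j; have := IHi j.+1; case: (a i j); lia.
Qed.

Lemma lvl_le_col i j : lvl i j <= j.
Proof.
elim: i j => [|i IHi] //; elim=> [|j IHj]; first by rewrite lvln0.
by rewrite lvlSS; have := IHi j; have := IHi j.+1; case: (a i j); lia.
Qed.

(** Only the last entry of a chain can lie in the last row or the last column. *)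
Lemma lvl_diag i j : lvl i.+1 j.+1 <= (lvl i j).+1.
Proof.
elim: i j => [|i IHi]; first by move=> j; exact: lvl_le_row.
elim=> [|j IHj]; first exact: lvl_le_col.
rewrite lvlSS 2!geq_max.
have := IHi j.+1; have := IHj.
have := @lvl_mono i j.+1 i.+1 j.+1 (leqnSn _) (leqnn _).
have := @lvl_mono i.+1 j i.+1 j.+1 (leqnn _) (leqnSn _).
by case: (a _ _); lia.
Qed.

Lemma jump_rel i j : a i j -> jump i j.
Proof. by rewrite /jump lvlSS => ->; lia. Qed.

Lemma jump_lvl i j i' j' : jump i j -> i < i' -> j < j' -> lvl i j < lvl i' j'.
Proof. by move=> h lti ltj; apply: (leq_trans h); exact: lvl_mono. Qed.

Lemma lvl_chain i j : exists r c : nat -> nat,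
  [/\ forall s, s < lvl i j -> [/\ r s < i, c s < j & a (r s) (c s)],
      forall s t, s < t < lvl i j -> r s < r t
    & forall s t, s < t < lvl i j -> c s < c t].
Proof.
elim: i j => [|i IHi]; first by exists id, id; split=> [s|s t|s t] //; lia.
elim=> [|j [r [c [hin hr hc]]]].
  by exists id, id; rewrite lvln0; split=> [s|s t|s t] //; lia.
have [r1 [c1 [hin1 hr1 hc1]]] := IHi j.+1.
have [r2 [c2 [hin2 hr2 hc2]]] := IHi j.
rewrite lvlSS.
have [h|h] := leqP (lvl i j + a i j) (maxn (lvl i j.+1) (lvl i.+1 j)).
  have [h'|h'] := leqP (lvl i j.+1) (lvl i.+1 j).
    exists r, c; split=> // s /hin[*]; split=> //; lia.
  exists r1, c1; split=> // s /hin1[*]; split=> //; lia.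
have aij : a i j.
  have := @lvl_mono i j i j.+1 (leqnn _) (leqnSn _).
  by move: h; case: (a i j) => //; lia.
rewrite aij addn1.
exists (fun s => if s < lvl i j then r2 s else i),
       (fun s => if s < lvl i j then c2 s else j); split=> [s _|s t h1|s t h1].
- by case: ifP => // /hin2[*]; split=> //; lia.
- have hs : s < lvl i j by lia.
  rewrite hs; case: ifP => ht; first by apply: hr2; lia.
  by have [] := hin2 s hs.
- have hs : s < lvl i j by lia.
  rewrite hs; case: ifP => ht; first by apply: hc2; lia.
  by have [] := hin2 s hs.
Qed.

Lemma lvl_diag_run i j t :
  (forall s, s < t -> a (i + s) (j + s)) -> t <= lvl (i + t) (j + t).
Proof.
elim: t => // t IHt h; rewrite !addnS lvlSS h //.
have : t <= lvl (i + t) (j + t) by apply: IHt => s hs; apply: h; lia.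
by lia.
Qed.

(** A discrete intermediate value argument: by [lvl_diag], levels rise by at most one per step along
    a diagonal, so the position just before the first excess over [t] has level exactly [t]. *)
Lemma diag_jump i j e t : lvl i j <= t -> t < lvl (i + e) (j + e) ->
  exists s, [/\ s < e, lvl (i + s) (j + s) = t & jump (i + s) (j + s)].
Proof.
move=> h0 he; have ex : exists s, t < lvl (i + s) (j + s) by exists e.
case: (ex_minnP ex) => [[|s] hs hmin]; first by move: hs; rewrite !addn0; lia.
have hse := hmin e he.
have hle : lvl (i + s) (j + s) <= t.
  by rewrite leqNgt; apply/negP => /hmin; lia.
have := lvl_diag (i + s) (j + s); move: hs; rewrite !addnS => h1 h2.
by exists s; split=> //; rewrite /jump; lia.
Qed.

End Level.

(** * Chains and levels in matrices *)

Section Matrix.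

Variables m n : nat.
Implicit Types (A B : 'M[bool]_(m, n)) (S : {set 'I_m * 'I_n}) (K : nat).

(** Extends the matrix by 0's, so that levels are computed without ordinals. *)
Definition mxrel A : rel nat :=
  fun i j => [exists x, [&& val x.1 == i, val x.2 == j & A x.1 x.2]].

Lemma mxrelE A (i : 'I_m) (j : 'I_n) : mxrel A i j = A i j.
Proof.
apply/existsP/idP => [[[i' j'] /= /and3P[/eqP/val_inj-> /eqP/val_inj->]] //|h].
by exists (i, j); rewrite !eqxx.
Qed.

(** Levels strictly increase along a chain of jumps, so entry [s], counted from 0, has level at
    least [s], and a jump at entry [K] would push the level above [K]. *)
Lemma avoids_jumps (a : rel nat) K A : lvl a m n <= K ->
  (forall (i : 'I_m) (j : 'I_n), A i j -> jump a i j) -> avoids_incr K.+1 A.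
Proof.
move=> hK hA [r [c [hr hc hone]]].
have hlvl s (hs : s < K.+1) : s <= lvl a (r (Ordinal hs)) (c (Ordinal hs)).
  elim: s hs => // s IHs hs; have hs' : s < K.+1 by lia.
  apply: (leq_ltn_trans (IHs hs')); apply: jump_lvl; first exact: hA.
    exact: hr.
  exact: hc.
have hj := hA _ _ (hone ord_max); have := hlvl K (ltnSn K).
rewrite (_ : Ordinal _ = ord_max); last exact: val_inj.
have := @lvl_mono a (r ord_max).+1 (c ord_max).+1 m n (ltn_ord _) (ltn_ord _).
by move: hj; rewrite /jump; lia.
Qed.

Lemma avoids_lvl K A : avoids_incr K.+1 A -> lvl (mxrel A) m n <= K.
Proof.
move=> av; rewrite leqNgt; apply/negP => hK; apply: av.
have [r [c [hin hr hc]]] := lvl_chain (mxrel A) m n.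
have hs (s : 'I_K.+1) : s < lvl (mxrel A) m n by have := ltn_ord s; lia.
have hrm (s : 'I_K.+1) : r s < m by have [] := hin s (hs s).
have hcn (s : 'I_K.+1) : c s < n by have [] := hin s (hs s).
exists (fun s => Ordinal (hrm s)), (fun s => Ordinal (hcn s)).
split=> [s t h|s t h|s] /=.
- by apply: hr; rewrite h hs.
- by apply: hc; rewrite h hs.
- by have [_ _] := hin s (hs s); rewrite -mxrelE.
Qed.

Lemma avoids_sub K A B : (forall i j, A i j -> B i j) ->
  avoids_incr K B -> avoids_incr K A.
Proof. by move=> h av [r [c [hr hc ho]]]; apply: av; exists r, c; split; auto. Qed.

(** Numbers the diagonals from the upper right corner on; each step of an R-L zigzag path raises
    this number by one. *)
Definition diag (x : 'I_m * 'I_n) : nat := x.1 + (n.-1 - x.2).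

Definition level_set (a : rel nat) S t : {set 'I_m * 'I_n} :=
  [set x in S | lvl a x.1 x.2 == t].

Lemma card_level_sets a S K : (forall x, x \in S -> lvl a x.1 x.2 < K) ->
  #|S| = \sum_(t < K) #|level_set a S t|.
Proof.
case: K => [|K] hS.
  rewrite big_ord0; apply/eqP; rewrite cards_eq0; apply/eqP/setP => x.
  by rewrite inE; apply/negP => /hS.
rewrite -sum1_card.
(* Outside [S] the level may exceed [K], and the value of [inord] is then irrelevant. *)
rewrite (partition_big (fun x : 'I_m * 'I_n => inord (lvl a x.1 x.2) : 'I_K.+1) predT) //=.
apply: eq_bigr => t _; rewrite -sum1_card; apply: eq_bigl => x; rewrite !inE.
case xS: (x \in S) => //=.
by rewrite -val_eqE /= inordK // hS.
Qed.

Lemma sum_path_lengths K : K <= m -> K <= n ->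
  \sum_(t < K) (m + n - (2 * t + 1)) = K * (m + n - K).
Proof.
move=> hm hn.
suff h j : j <= K -> \sum_(t < j) (m + n - (2 * t + 1)) = j * (m + n - j).
  exact: h.
elim: j => [|j IHj] hj; first by rewrite big_ord0.
rewrite big_ord_recr /= IHj; last by lia.
by rewrite !mulnBr; nia.
Qed.

(** * Level sets against diagonals *)

Section LevelSetOfJumps.

Variables (a : rel nat) (S : {set 'I_m * 'I_n}).
Hypothesis S_jump : forall x, x \in S -> jump a x.1 x.2.

Let incomparable t x y : x \in level_set a S t -> y \in level_set a S t ->
  ~~ ((x.1 < y.1) && (x.2 < y.2)).
Proof.
rewrite !inE => /andP[/S_jump xj /eqP xt] /andP[_ /eqP yt].
by apply/negP => /andP[h1 h2]; have := jump_lvl xj h1 h2; lia.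
Qed.

(** Distinct positions on one diagonal are strictly comparable. *)
Lemma diag_inj t : {in level_set a S t &, injective diag}.
Proof.
move=> [i j] [i' j'] hx hy; have := incomparable hx hy; have := incomparable hy hx.
rewrite /diag /= => h1 h2 h; have := ltn_ord j; have := ltn_ord j' => hj hj'.
by congr (_, _); apply: val_inj => /=; lia.
Qed.

Lemma diag_bounds t x : x \in level_set a S t -> t <= diag x < m + n - t.+1.
Proof.
rewrite inE => /andP[_ /eqP <-]; rewrite /diag.
have := ltn_ord x.1; have := ltn_ord x.2.
have := lvl_le_row a x.1 x.2; have := lvl_le_col a x.1 x.2.
by move: (nat_of_ord x.1) (nat_of_ord x.2); lia.
Qed.

Let diags t : seq nat := iota t (m + n - (2 * t + 1)).

Let uniq_diag t : uniq (map diag (enum (level_set a S t))).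
Proof.
rewrite map_inj_in_uniq ?enum_uniq // => x y; rewrite !mem_enum.
exact: diag_inj.
Qed.

Let sub_diags t : {subset map diag (enum (level_set a S t)) <= diags t}.
Proof.
move=> d /mapP[x]; rewrite mem_enum => /diag_bounds h ->.
by rewrite mem_iota; lia.
Qed.

Lemma card_level_set t : #|level_set a S t| <= m + n - (2 * t + 1).
Proof.
rewrite cardE -(size_map diag) -[leqRHS](size_iota t).
exact: uniq_leq_size (uniq_diag t) (@sub_diags t).
Qed.

(** From one diagonal to the next, every displacement other than one step left or one step down
    makes the two positions strictly comparable. *)
Lemma rl_step_consecutive t :
  {in level_set a S t &, forall x y, diag y = (diag x).+1 -> rl_step x y}.
Proof.
move=> [i j] [i' j'] hx hy; have := incomparable hx hy; have := incomparable hy hx.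
rewrite /diag /rl_step /= -!val_eqE /=.
have := ltn_ord j; have := ltn_ord j'; lia.
Qed.

Definition level_path t : seq ('I_m * 'I_n) :=
  sort (relpre diag leq) (enum (level_set a S t)).

Lemma mem_level_path t x : (x \in level_path t) = (x \in level_set a S t).
Proof. by rewrite mem_sort mem_enum. Qed.

Lemma size_level_path t : size (level_path t) = #|level_set a S t|.
Proof. by rewrite size_sort cardE. Qed.

Lemma sorted_level_path t : #|level_set a S t| = m + n - (2 * t + 1) ->
  sorted (@rl_step m n) (level_path t).
Proof.
move=> hcard.
(* The diagonals met are distinct members of [diags t] and as many as it has, hence all of them. *)
have eq_diags : map diag (level_path t) = diags t.
  apply: (sorted_eq leq_trans anti_leq).
  - by rewrite sorted_map; apply: sort_sorted => x y; exact: leq_total.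
  - exact: iota_sorted.
  apply: (@perm_trans _ (map diag (enum (level_set a S t)))).
    by apply: perm_map; rewrite perm_sort.
  apply: uniq_perm; rewrite ?uniq_diag ?iota_uniq //.
  have [|//] := uniq_min_size (uniq_diag t) (@sub_diags t).
  by rewrite size_iota size_map -cardE hcard.
have : sorted (relpre diag (fun d e => e == d.+1)) (level_path t).
  rewrite -sorted_map eq_diags /diags.
  by case: (m + n - _) => //= l; elim: l (t) => //= l IHl d; rewrite eqxx IHl.
apply: (@sub_in_sorted _ [in level_set a S t]).
  by move=> x y hx hy /eqP; exact: rl_step_consecutive hx hy.
by apply/allP => x; rewrite mem_level_path.
Qed.

End LevelSetOfJumps.

(** * Extremal matrices and completion *)

Section Extremal.

Variables (K : nat) (A : 'M[bool]_(m, n)).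
Hypotheses (K_le_m : K <= m) (K_le_n : K <= n) (avA : avoids_incr K.+1 A).

Let ones_jump x : x \in ones A -> jump (mxrel A) x.1 x.2.
Proof. by rewrite inE -mxrelE; exact: jump_rel. Qed.

Let ones_lvl x : x \in ones A -> lvl (mxrel A) x.1 x.2 < K.
Proof.
move=> /ones_jump xj; apply: leq_trans (avoids_lvl avA).
exact: jump_lvl xj (ltn_ord _) (ltn_ord _).
Qed.

Lemma card_ones_avoids : #|ones A| <= K * (m + n - K).
Proof.
rewrite (card_level_sets ones_lvl) -sum_path_lengths //.
by apply: leq_sum => t _; exact: card_level_set.
Qed.

Lemma zigzag_partition : #|ones A| = K * (m + n - K) ->
  exists P : 'I_K -> seq ('I_m * 'I_n),
    [/\ (forall t, rl_zigzag (P t)),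
        (forall t, size (P t) = m + n - (2 * t + 1)),
        (forall t x, x \in P t -> x \in ones A) &
        forall x, x \in ones A -> exists! t, x \in P t].
Proof.
rewrite (card_level_sets ones_lvl) -sum_path_lengths // => eq_sum.
have hcard (t : 'I_K) :
    #|level_set (mxrel A) (ones A) t| = m + n - (2 * t + 1).
  (* Equality of the sums forces equality in each termwise bound. *)
  have [_] := leqif_sum (fun (t : 'I_K) (_ : true) =>
    leqif_eq (card_level_set ones_jump t)).
  by rewrite eq_sum eqxx => /esym/forallP/(_ t)/eqP.
exists (fun t : 'I_K => level_path (mxrel A) (ones A) t); split.
- move=> t; rewrite /rl_zigzag sorted_level_path // andbT -size_eq0.
  rewrite size_level_path hcard; have := ltn_ord t; lia.
- by move=> t; rewrite size_level_path hcard.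
- by move=> t x; rewrite mem_level_path inE => /andP[].
move=> x hx; exists (Ordinal (ones_lvl hx)); split=> [|t].
  by rewrite mem_level_path inE hx /=.
by rewrite mem_level_path inE => /andP[_ /eqP h]; apply: val_inj.
Qed.

Definition fill_corners : 'M[bool]_(m, n) :=
  \matrix_(i, j) [|| A i j, i + n <= j + K | m + j <= i + K].

(** Entry [t] of a chain of length [K.+1] has [t] entries before it and [K - t] after it; this keeps
    it out of both corners, so the chain already lies in [A]. *)
Lemma avoids_fill_corners : avoids_incr K.+1 fill_corners.
Proof.
move=> [r [c [hr hc hone]]]; apply: avA; exists r, c; split=> // t.
have incr_ge p (f : 'I_K.+1 -> 'I_p) :
    (forall s t : 'I_K.+1, s < t -> f s < f t) -> t <= f t /\ f t + K < p + t.
  move=> hf; split.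
    case: t => t; elim: t => // t IHt ht; have ht' : t < K.+1 by lia.
    exact: leq_ltn_trans (IHt ht') (hf (Ordinal ht') (Ordinal ht) (ltnSn t)).
  (* Induction from the last entry backwards. *)
  suff h d : d <= K -> f (inord (K - d)) + d < p.
    have := h (K - t) (leq_subr _ _); rewrite subKn; last by have := ltn_ord t; lia.
    by rewrite inord_val; have := ltn_ord t; lia.
  elim: d => [|d IHd] hd; first by rewrite addn0.
  have hlt : f (inord (K - d.+1)) < f (inord (K - d)).
    by apply: hf; rewrite !inordK; lia.
  by have := IHd (ltnW hd); lia.
have [h1 h2] := incr_ge _ _ hr; have [h3 h4] := incr_ge _ _ hc.
have := hone t; rewrite mxE => /or3P[//| |]; lia.
Qed.

Let b : rel nat := mxrel fill_corners.

Let corner_b i j : i < m -> j < n -> (i + n <= j + K) || (m + j <= i + K) ->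
  b i j.
Proof.
move=> hi hj h; rewrite -[i]/(val (Ordinal hi)) -[j]/(val (Ordinal hj)) /b.
by rewrite mxrelE mxE h orbT.
Qed.

(** A diagonal of [t.+1] filled positions in the lower left corner ends in the last row, at column
    [t]. *)
Let lvl_bottom t j : t < K -> t < j -> t < lvl b m j.
Proof.
move=> ht hj; apply: (@leq_trans (lvl b m t.+1)); last exact: lvl_mono.
have := @lvl_diag_run b (m - t.+1) 0 t.+1; rewrite subnK ?add0n; last by lia.
by apply=> s hs; apply: corner_b; lia.
Qed.

Let lvl_right t i : t < K -> t < i -> t < lvl b i n.
Proof.
move=> ht hi; apply: (@leq_trans (lvl b t.+1 n)); last exact: lvl_mono.
have := @lvl_diag_run b 0 (n - t.+1) t.+1; rewrite subnK ?add0n; last by lia.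
by apply=> s hs; apply: corner_b; lia.
Qed.

Definition completion : 'M[bool]_(m, n) :=
  \matrix_(i, j) jump (mxrel fill_corners) i j.

Lemma completion_sub i j : A i j -> completion i j.
Proof. by move=> h; rewrite mxE; apply: jump_rel; rewrite mxrelE mxE h. Qed.

Lemma avoids_completion : avoids_incr K.+1 completion.
Proof.
apply: (avoids_jumps (avoids_lvl avoids_fill_corners)) => i j.
by rewrite mxE.
Qed.

Let completion_diag t d : t < K -> t <= d < m + n - t.+1 ->
  exists2 x, x \in level_set b (ones completion) t & diag x = d.
Proof.
(* By truncated subtraction [i] or [j] is 0, so [(i, j)] is where diagonal [d] enters the matrix;
   [e] is the length of that diagonal. *)
move=> ht hd; pose i := d - n.-1; pose j := n.-1 - d.
pose e := minn (m - i) (n - j).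
have h0 : lvl b i j <= t.
  by have := lvl_le_row b i j; have := lvl_le_col b i j; lia.
have he : t < lvl b (i + e) (j + e).
  have [h|h] := leqP (m - i) (n - j).
    by rewrite (_ : i + e = m); [apply: lvl_bottom|]; lia.
  by rewrite (_ : j + e = n); [apply: lvl_right|]; lia.
have [s [hs ls js]] := diag_jump h0 he.
have hi : i + s < m by lia.
have hj : j + s < n by lia.
exists (Ordinal hi, Ordinal hj); last by rewrite /diag /=; lia.
by rewrite !inE /= ls eqxx mxE /= js.
Qed.

Lemma card_completion : K * (m + n - K) <= #|ones completion|.
Proof.
have hlvl x : x \in ones completion -> lvl b x.1 x.2 < K.
  rewrite inE mxE => xj; apply: leq_trans (avoids_lvl avoids_fill_corners).
  exact: jump_lvl xj (ltn_ord _) (ltn_ord _).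
rewrite (card_level_sets hlvl) -sum_path_lengths //.
apply: leq_sum => t _; rewrite cardE -(size_map diag) -[leqLHS](size_iota t).
apply: uniq_leq_size (iota_uniq _ _) _ => d; rewrite mem_iota => hd.
have [||x hx <-] := @completion_diag t d; [exact: ltn_ord|lia|].
by apply: map_f; rewrite mem_enum.
Qed.

(** Any 1 of [completion] that is a 0 of [A] will do: the new matrix stays below [completion]. *)
Lemma avoids_set_one : #|ones A| < K * (m + n - K) ->
  exists (i : 'I_m) (j : 'I_n),
    A i j = false /\ avoids_incr K.+1 (set_one A i j).
Proof.
move=> hlt; have : ~~ (ones completion \subset ones A).
  apply/negP => /subset_leq_card; have := card_completion; lia.
case/subsetPn=> [[i j]]; rewrite !inE /= => hC /negbTE hA.
exists i, j; split=> //; apply: avoids_sub avoids_completion => i' j'.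
by rewrite mxE => /orP[/andP[/eqP-> /eqP->]|/completion_sub].
Qed.

End Extremal.

End Matrix.

Theorem theorem2p7 (m n k : nat) (hk : 3 <= k) (hm : k <= m) (hn : k <= n) :
  [/\ (exists A : 'M[bool]_(m, n),
         avoids_incr k A /\ #|ones A| = (k - 1) * (m + n - (k - 1)))
      /\ (forall A : 'M[bool]_(m, n),
            avoids_incr k A -> #|ones A| <= (k - 1) * (m + n - (k - 1))),
      forall A : 'M[bool]_(m, n),
        avoids_incr k A -> #|ones A| = (k - 1) * (m + n - (k - 1)) ->
        exists P : 'I_(k - 1) -> seq ('I_m * 'I_n),
          [/\ (forall t, rl_zigzag (P t)),
              (forall t, size (P t) = m + n - (2 * t + 1)),
              (forall t x, x \in P t -> x \in ones A) &
              forall x, x \in ones A -> exists! t, x \in P t]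
    & forall A : 'M[bool]_(m, n),
        avoids_incr k A -> #|ones A| < (k - 1) * (m + n - (k - 1)) ->
        exists (i : 'I_m) (j : 'I_n),
          A i j = false /\ avoids_incr k (set_one A i j)].
Proof.
case: k hk hm hn => // K _ /ltnW hm /ltnW hn; rewrite subn1 /=.
split; [split|..] => [|A avA|A avA|A avA].
- have av0 : avoids_incr K.+1 (const_mx false : 'M[bool]_(m, n)).
    by move=> [r [c [_ _ /(_ ord0)]]]; rewrite mxE.
  (* Completing the zero matrix attains the bound. *)
  exists (completion K (const_mx false)); split; first exact: avoids_completion.
  apply/eqP; rewrite eqn_leq card_completion // andbT.
  by apply: card_ones_avoids => //; exact: avoids_completion.
- exact: card_ones_avoids hm hn avA.
- exact: zigzag_partition hm hn avA.
- exact: avoids_set_one hm hn avA.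
Qed.
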